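(* For input $x$ chosen uniformly at random from $[n]^{2n-1}$, $ED^{\boxplus n}$ can be solved (with no error) by an algorithm whose average time is $\overline T\in O(n)$ and average space is $\overline S\in O(\log n)$.
   Context: $ED_n(y_1,\ldots,y_n)=1$ if the $y_i$ are pairwise distinct and $0$ otherwise. $ED^{\boxplus n}$ maps $x=(x_1,\ldots,x_{2n-1})$ to $(ED_n(x_i,\ldots,x_{i+n-1}))_{i=1}^n$. Averages are over the uniform input distribution. *)

(* Defs.v *)
From mathcomp Require Import all_boot all_order all_algebra.
From mathcomp Require Import all_classical all_reals all_analysis.

Set Implicit Arguments.
Unset Strict Implicit.
Unset Printing Implicit Defensive.

Definition ED (T : eqType) (n : nat) (y : n.-tuple T) : nat := uniq y.

Fact window_bound (n : nat) (i j : 'I_n) : (i + j < 2 * n - 1)%N.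
Proof.
case: n i j => [[]//|n] i j.
rewrite mul2n -addnn addSn subn1 /= addnS ltnS.
by apply: leq_add; rewrite -ltnS.
Qed.

Definition window (T : Type) (n : nat) (x : (2 * n - 1).-tuple T) (i : 'I_n) :
  n.-tuple T := [tuple tnth x (Ordinal (window_bound i j)) | j < n].

Definition ED_boxplus (T : eqType) (n : nat) (x : (2 * n - 1).-tuple T) :
  n.-tuple nat := [tuple ED (window x i) | i < n].

(* A random access machine with a read-only input, an unbounded memory M of
   natural numbers, and a write-only output tape that is filled from left to
   right.  Instruction operands are addresses of memory cells, except for the
   constant of [Const] and the jump targets; [Get] and [Put] are the indirect
   load and store. *)
Inductive instr : Type :=
| Const of nat & nat
| Add of nat & nat & nat
| Sub of nat & nat & nat
| Get of nat & nat
| Put of nat & nat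
| Read of nat & nat
| Write of nat
| Jump of nat
| JumpLt of nat & nat & nat.

Definition program := seq instr.

(* Cells beyond the end of [mem] have never been written and contain 0. *)
Record config : Type :=
  Config { pc : nat; mem : seq nat; output : seq nat }.

Definition exec_instr (inp : seq nat) (i : instr) (c : config) : config :=
  let: Config p m o := c in
  let M a := nth 0 m a in
  let upd d v := Config p.+1 (set_nth 0 m d v) o in
  match i with
  | Const d k => upd d k
  | Add d a b => upd d (M a + M b)
  | Sub d a b => upd d (M a - M b)
  | Get d a => upd d (M (M a))
  | Put d a => upd (M d) (M a)
  | Read d a => upd d (nth 0 inp (M a))
  | Write a => Config p.+1 m (rcons o (M a))
  | Jump l => Config l m o
  | JumpLt a b l => Config (if M a < M b then l else p.+1) m o
  end.

Definition halted (P : program) (c : config) : bool := size P <= pc c.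

Definition step (P : program) (inp : seq nat) (c : config) : config :=
  if halted P c then c else exec_instr inp (nth (Jump 0) P (pc c)) c.

Definition bitlen (k : nat) : nat := (trunc_log 2 k).+1.

(* Every cell up to the largest address written so far is charged for, and at
   least one bit per cell; as usual the input and the output are not. *)
Definition config_space (c : config) : nat := \sum_(k <- mem c) bitlen k.

(* The size parameter [n] is initially in M[0]; the symbols of the alphabet
   [n] are represented by 0, ..., n - 1 and input positions start at 0. *)
Definition config_at (P : program) (n : nat) (inp : seq nat) (t : nat) :
  config := iter t (step P inp) (Config 0 [:: n] [::]).

(* [t] (the number of executed instructions) and [s] are determined by [P],
   [n] and [inp], since execution is deterministic. *)
Definition run (P : program) (n : nat) (inp out : seq nat) (t s : nat) : Prop :=
  let c := config_at P n inp in
  [/\ halted P (c t),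
      forall k, k < t -> ~~ halted P (c k),
      output (c t) = out
    & s = \max_(k < t.+1) config_space (c k)].

Definition average (R : realType) (I : finType) (f : I -> nat) : R :=
  ((\sum_(i : I) f i)%:R / #|I|%:R)%R.

(* Main.v *)
(* With m = ceil(n/2), every window starting at s <= m contains the block [m,
   n), and every window starting at s >= m contains the block [n, n + m). So as
   soon as both blocks contain a repeated symbol all outputs are 0. Each block
   is searched naively, comparing its elements, from right to left, with all
   later ones, until a repetition is found; if one of the searches fails, every
   window is searched. Only a constant number of integers of size O(n) is
   stored, so the space is O(log n) in the worst case. Let p k be the
   probability that k given positions carry distinct symbols; n p (k+1) = (n -
   k) p k. Summation by parts gives \sum_k k p k <= n, so that the two searches
   take expected time O(n), and, for k >= 1, (k^4 + 15 n k^2 + 45 n^2) p k is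
   nonincreasing in k, so that a search fails with probability O(n^-2), which
   compensates for the O(n^3) cost of the exhaustive search. *)
Require Import Defs.
From mathcomp Require Import all_boot all_order all_algebra.
From mathcomp Require Import all_classical all_reals all_analysis.
From mathcomp Require Import zify ring lra.
Import Order.TTheory GRing.Theory Num.Theory.
Import numFieldNormedType.Exports.

Set Implicit Arguments.
Unset Strict Implicit.
Unset Printing Implicit Defensive.

Local Open Scope classical_set_scope.
Local Open Scope nat_scope.

(** * Counting inputs with distinct symbols on a segment *)

Lemma sum_uniq_tuple (T : finType) (k : nat) :
  \sum_(t : k.-tuple T) (uniq t : nat) = #|T| ^_ k.
Proof.
rewrite -(card_uniq_tuples k (T := T) predT) -sum1_card [RHS]big_mkcond /=.
by apply: eq_bigr => t _; rewrite inE all_predT; case: uniq.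
Qed.

Lemma sum_uniq_segment (T : finType) (N a k : nat) : a + k <= N ->
  \sum_(x : N.-tuple T) (uniq (take k (drop a x)) : nat) =
    #|T| ^_ k * #|T| ^ (N - k).
Proof.
move=> akN; have [b eN] : exists b, N = a + (k + b).
  by exists (N - (a + k)); rewrite addnA subnKC.
subst N => {akN}.
(* Cutting the input before and after the segment makes the three parts independent; bijectivity
   follows from injectivity by counting. *)
pose cat3 (p : a.-tuple T * (k.-tuple T * b.-tuple T)) :=
  [tuple of p.1 ++ (p.2.1 ++ p.2.2)].
have cat3_inj : injective cat3.
  move=> [x [y z]] [x' [y' z']] /(congr1 (@tval _ _))/eqP /=.
  rewrite eqseq_cat ?size_tuple // => /andP[/eqP/val_inj ->].
  by rewrite eqseq_cat ?size_tuple // => /andP[/eqP/val_inj -> /eqP/val_inj ->].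
have cat3_bij : bijective cat3.
  by apply: inj_card_bij cat3_inj _; rewrite !card_prod !card_tuple -!expnD.
rewrite (reindex cat3) /=; last exact: onW_bij.
transitivity (\sum_(p : a.-tuple T * (k.-tuple T * b.-tuple T)) (uniq p.2.1 : nat)).
  apply: eq_bigr => -[x [y z]] _ /=.
  by rewrite drop_size_cat ?size_tuple // take_size_cat ?size_tuple.
rewrite -(pair_bigA addn (fun (_ : a.-tuple T) (r : k.-tuple T * b.-tuple T) =>
  (uniq r.1 : nat))) /= sum_nat_const card_tuple.
rewrite -(pair_bigA addn (fun (y : k.-tuple T) (_ : b.-tuple T) =>
  (uniq y : nat))) /=.
under eq_bigr do rewrite sum_nat_const card_tuple.
by rewrite -big_distrr sum_uniq_tuple /= addnCA addKn expnD mulnA mulnC.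
Qed.

(** * Weighted bounds on the number of collision-free inputs *)

Section CollisionWeights.
Variables (n : nat) (q : nat -> nat).
(* Satisfied by the number of inputs with distinct symbols at k given positions. *)
Hypothesis qS : forall k, k < n -> n * q k.+1 = (n - k) * q k.

(** The sum telescopes, since [qS] says that [k * q k] is [n * q k - n * q k.+1]; the remainder
    stays on the left to avoid truncated subtraction. *)
Lemma sum_weights K : K <= n ->
  \sum_(0 <= k < K) k * q k + n * q K = n * q 0.
Proof.
elim: K => [|K IH] KN; first by rewrite big_geq.
rewrite big_nat_recr //= qS // -addnA -mulnDl subnKC ?IH //; exact: ltnW.
Qed.

Lemma sum_weightsS K : 0 < n -> K <= n ->
  \sum_(0 <= k < K) k.+1 * q k <= 3 * (n * q 0).
Proof.
move=> n0 KN; case: K KN => [|K] KN; first by rewrite big_geq.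
have := sum_weights KN; rewrite !big_nat_recl //= mul0n add0n mul1n => H.
have : \sum_(0 <= i < K) i.+2 * q i.+1 <= 2 * \sum_(0 <= i < K) i.+1 * q i.+1.
  by rewrite big_distrr; apply: leq_sum => i _ /=; nia.
by nia.
Qed.

Lemma quartic_weight K : 0 < K <= n -> K ^ 4 * q K <= 61 * (n ^ 2 * q 0).
Proof.
move=> /andP[K0 Kn].
(* Monotonicity amounts to n (f(k+1) - f(k)) <= k f(k+1). For k >= 1, (k+1)^4 - k^4 <= 15 k^3 and 15
   ((k+1)^2 - k^2) <= 45 k, so each lower-order term of [f] absorbs the increment of the previous
   one. At 1, [f] is at most (1 + 15 + 45) n^2. *)
pose f k := k ^ 4 + 15 * n * k ^ 2 + 45 * n ^ 2.
have n0 : 0 < n by lia.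
suff decr : f K * q K <= f 1 * q 1.
  have q1 : q 1 = q 0 by apply/eqP; rewrite -(eqn_pmul2l n0) qS // subn0.
  rewrite q1 in decr.
  apply: leq_trans (leq_mul _ (leqnn (q K))) (leq_trans decr _).
    by rewrite /f; lia.
  by rewrite mulnA leq_mul // /f; nia.
elim: K K0 Kn => [//|[//|k] IH] _ kn.
apply: leq_trans (IH isT (ltnW kn)).
rewrite -(leq_pmul2l n0) mulnCA qS // mulnA [n * _]mulnA leq_mul // mulnC.
(* In terms of [d] and [k] the difference of the two sides is a polynomial with nonnegative
   coefficients. *)
have [d nd] : exists d, n = k.+1 + d by exists (n - k.+1); lia.
rewrite /f nd addKn.
have -> : (k.+1 + d) *
    (k.+1 ^ 4 + 15 * (k.+1 + d) * k.+1 ^ 2 + 45 * (k.+1 + d) ^ 2) =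
   d * (k.+2 ^ 4 + 15 * (k.+1 + d) * k.+2 ^ 2 + 45 * (k.+1 + d) ^ 2) +
     (61 + 45 * d + 200 * k + 122 * k * d + 15 * k * d ^ 2 + 235 * k ^ 2 +
      87 * k ^ 2 * d + 115 * k ^ 3 + 11 * k ^ 3 * d + 20 * k ^ 4 + k ^ 5)
  by ring.
exact: leq_addr.
Qed.

(** After multiplication by [n], n^4 <= (3K)^4 = 81 K^4 and [quartic_weight] applies. The ratio 3 is
    what the shorter block, of length floor(n/2), satisfies for all n > 1. *)
Lemma fail_weight K : 1 < n -> n <= 3 * K -> K <= n ->
  n * (n * n) * q K <= 81 * 61 * (n * q 0).
Proof.
move=> n1 nK Kn; have := @quartic_weight K.
have -> : 0 < K <= n by lia.
move/(_ isT) => H.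
have n0 : 0 < n by lia.
rewrite -(leq_pmul2l n0).
apply: (@leq_trans (81 * (K ^ 4 * q K))).
  have -> : n * (n * (n * n) * q K) = n ^ 4 * q K by ring.
  have -> : 81 * (K ^ 4 * q K) = (3 * K) ^ 4 * q K by ring.
  by rewrite leq_mul // leq_exp2r.
have -> : n * (81 * 61 * (n * q 0)) = 81 * (61 * (n ^ 2 * q 0)) by ring.
by rewrite leq_mul2l H.
Qed.
End CollisionWeights.

(* Registers: 0 = n, 1 = 1, 2 = m, 3 = start s of the current window, 4 and 5 =
   bounds lo and hi of the current search, 6 = i, 7 = j, 8 = x_i, 9 = x_j,
   10 = phase, 11 = 0.  Phases 0, 1, 2 are the search of the left block, of the
   right block and of the window s.  The search of [lo, hi) starts at 7, and
   ends at 21 if a repetition was found and at 31 otherwise. *)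
Definition ed_prog : program := [::
  (*  0 *) Const 11 0; Const 1 1;
  (*  2 *) Add 2 2 1; Add 7 2 2; JumpLt 7 0 2;
  (*  5 *) Add 4 2 11; Add 5 0 11;
  (*  7 *) Add 6 5 11;
  (*  8 *) JumpLt 4 6 10; Jump 31;
  (* 10 *) Defs.Sub 6 6 1; Read 8 6; Add 7 6 1;
  (* 13 *) JumpLt 7 5 15; Jump 8;
  (* 15 *) Read 9 7; JumpLt 8 9 19; JumpLt 9 8 19; Jump 21;
  (* 19 *) Add 7 7 1; Jump 13;
  (* 21 *) JumpLt 10 1 27; JumpLt 1 10 36;
  (* 23 *) Write 11; Add 3 3 1; JumpLt 3 0 23; Jump 41;
  (* 27 *) Const 10 1; Add 4 0 11; Add 5 0 2; Jump 7;
  (* 31 *) JumpLt 1 10 38;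
  (* 32 *) Const 10 2;
  (* 33 *) Add 4 3 11; Add 5 3 0; Jump 7;
  (* 36 *) Write 11; Jump 39;
  (* 38 *) Write 1;
  (* 39 *) Add 3 3 1; JumpLt 3 0 33].

(** * Executions with bounded time and memory *)

Definition mem_bounded (V : nat) (c : config) : bool :=
  (size (Defs.mem c) <= 12) && all (fun v => v <= V) (Defs.mem c).

Section Reach.
Variables (P : program) (inp : seq nat) (V : nat).

(** Only the configurations strictly before the end are constrained, so that executions compose and
    the last one may be halted; its memory is checked separately. *)
Definition reach (c c' : config) (T : nat) : Prop :=
  exists2 t, t <= T & iter t (step P inp) c = c' /\
    forall k, k < t -> ~~ halted P (iter k (step P inp) c) &&
                       mem_bounded V (iter k (step P inp) c).

Lemma reach_refl c T : reach c c T.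
Proof. by exists 0. Qed.

Lemma reach_trans c2 T1 T2 c1 c3 T :
  reach c1 c2 T1 -> reach c2 c3 T2 -> T1 + T2 <= T -> reach c1 c3 T.
Proof.
move=> [t1 le1 [e1 h1]] [t2 le2 [e2 h2]] leT.
exists (t2 + t1); first by lia.
split=> [|k ltk]; first by rewrite iterD e1.
case: (ltnP k t1) => [/h1//|le_t1k].
by rewrite -(subnK le_t1k) iterD e1 h2 //; lia.
Qed.

Lemma reach_step c c' T : ~~ halted P c -> mem_bounded V c ->
  reach (exec_instr inp (nth (Jump 0) P (pc c)) c) c' T -> reach c c' T.+1.
Proof.
move=> hc bc [t leT [e h]]; exists t.+1 => //.
have es : step P inp c = exec_instr inp (nth (Jump 0) P (pc c)) c.
  by rewrite /step (negbTE hc).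
split=> [|[|k] ltk]; first by rewrite iterSr es.
  by rewrite /= hc.
by rewrite iterSr es h.
Qed.

End Reach.

(** * Execution of the program on a fixed input *)

Section Program.
Variables (n : nat) (inp : seq nat) (V : nat).
Hypothesis nV : n <= V.
Hypothesis twoV : 2 <= V.
Hypothesis inpV : all (fun v => v <= V) inp.

Local Notation reach := (reach ed_prog inp V).
Local Notation X := (nth 0 inp).

Local Notation st pc m s lo hi i j xi xj md o := (
  Config pc [:: n; 1; m; s; lo; hi; i; j; xi; xj; md; 0] o).

Lemma XV i : X i <= V.
Proof.
have [lt|ge] := ltnP i (size inp); last by rewrite nth_default.
by move/all_nthP: inpV; apply.
Qed.

(* The memory of a run is a list of 12 terms, so one instruction is executed by
   computation. *)
Ltac machine_step :=
  apply: reach_step; [by [] | rewrite /mem_bounded /=; lia | rewrite /=].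

Lemma reach_inner m s lo hi i xi md o d j xj :
    m <= V -> s <= V -> lo <= V -> hi <= V -> i <= V -> xi <= V -> md <= V ->
    xj <= V -> j + d = hi ->
  exists j' xj', [/\ j' <= V, xj' <= V &
    reach (st 13 m s lo hi i j xi xj md o)
      (st (if xi \in map X (iota j d) then 21 else 8) m s lo hi i j' xi xj' md o)
      (7 * d + 2)].
Proof.
move=> mV sV loV hiV iV xiV mdV.
elim: d j xj => [|d IH] j xj xjV eqhi.
  exists j, xj; split=> //; first by lia.
  machine_step; have -> : (j < hi) = false by lia.
  machine_step; exact: reach_refl.
have XjV := XV j.
have [eqX|neqX] := eqVneq xi (X j).
  exists j, (X j); split=> //; first by lia.
  rewrite /= in_cons eqX eqxx /=.
  rewrite -eqX in XjV *.
  apply: (@reach_trans _ _ _ (st 21 m s lo hi i j xi xi md o) 5 (7 * d));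
    last 2 first.
  - exact: reach_refl.
  - by lia.
  machine_step; have -> : (j < hi) = true by lia.
  machine_step; rewrite -eqX.
  machine_step; rewrite ltnn.
  machine_step; rewrite ltnn.
  machine_step; exact: reach_refl.
have [j' [xj' [j'V xj'V run]]] := IH j.+1 (X j) XjV ltac:(lia).
exists j', xj'; split=> //.
rewrite /= in_cons (negbTE neqX) /=.
apply: (@reach_trans _ _ _ _ 7 (7 * d + 2)); [|exact: run|by lia].
machine_step; have -> : (j < hi) = true by lia.
machine_step.
(* Both orders of two different symbols lead to address 19; falling through both comparisons would
   mean equality. *)
have next T : reach (st 19 m s lo hi i j xi (X j) md o)
                    (st 13 m s lo hi i j.+1 xi (X j) md o) T.+2.
  by machine_step; machine_step; rewrite addn1; exact: reach_refl.
machine_step; case: ltnP => [_|le]; first exact: next.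
machine_step; case: ltnP => [_|le']; first exact: next.
by move: neqX; rewrite eqn_leq le' le.
Qed.

(** The block is anchored at its right end because the search extends it to the left. *)
Definition distinct_upto (hi k : nat) : bool := uniq (map X (iota (hi - k) k)).

(** Up to a constant factor, the cost of comparing an element with the [l] later ones, a stage
    entered only if those are distinct. *)
Definition search_cost (hi k : nat) : nat :=
  \sum_(0 <= l < k) l.+1 * distinct_upto hi l.

Lemma uniq_iota_sub a k b l : a <= b -> b + l <= a + k ->
  uniq (map X (iota a k)) -> uniq (map X (iota b l)).
Proof.
move=> ab bl.
have -> : k = (b - a) + (l + (a + k - (b + l))) by lia.
by rewrite !iotaD !map_cat !cat_uniq subnKC // => /and3P[_ _ /and3P[]].
Qed.

Lemma distinct_uptoS hi k : k < hi ->
  distinct_upto hi k.+1 =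
    (X (hi - k.+1) \notin map X (iota (hi - k) k)) && distinct_upto hi k.
Proof. by move=> lt; rewrite /distinct_upto /= -subSn ?subSS. Qed.

Lemma reach_scan m s lo hi md o d k j xi xj :
    m <= V -> s <= V -> hi <= V -> md <= V -> j <= V -> xi <= V -> xj <= V ->
    k + d = hi - lo -> lo <= hi -> distinct_upto hi k ->
  exists i' j' xi' xj', [/\ i' <= V, j' <= V, xi' <= V, xj' <= V &
    reach (st 8 m s lo hi (hi - k) j xi xj md o)
      (st (if distinct_upto hi (hi - lo) then 31 else 21)
         m s lo hi i' j' xi' xj' md o)
      (2 + 12 * \sum_(k <= l < hi - lo) l.+1 * distinct_upto hi l)].
Proof.
move=> mV sV hiV mdV.
elim: d k j xi xj => [|d IH] k j xi xj jV xiV xjV kd lohi uk.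
  exists (hi - k), j, xi, xj; split=> //; first by lia.
  rewrite -kd addn0 uk; apply: (@reach_trans _ _ _ _ 2 0); last 2 first.
  - exact: reach_refl.
  - by lia.
  machine_step; have -> : (lo < hi - k) = false by lia.
  by machine_step; exact: reach_refl.
have XiV := XV (hi - k.+1).
have := @reach_inner m s lo hi (hi - k.+1) (X (hi - k.+1)) md o k (hi - k) xj.
case; try by lia.
move=> j1 [xj1 [j1V xj1V run1]].
have run2 : reach (st 8 m s lo hi (hi - k) j xi xj md o)
   (st (if X (hi - k.+1) \in map X (iota (hi - k) k) then 21 else 8)
      m s lo hi (hi - k.+1) j1 (X (hi - k.+1)) xj1 md o)
   (12 * (k.+1 * distinct_upto hi k)).
  apply: (@reach_trans _ _ _ _ 4 (7 * k + 2)); [|exact: run1|by rewrite uk; lia].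
  machine_step; have -> : (lo < hi - k) = true by lia.
  machine_step; machine_step; rewrite -subnDA addn1.
  machine_step; rewrite addn1 -subSn ?subSS; last by lia.
  exact: reach_refl.
have lt_k : k < hi - lo by lia.
case: ifP run2 => [Xin|/negbT Xnin] run2.
  (* A repetition among the last [k.+1] elements is one in the whole block. *)
  have nu : ~~ distinct_upto hi (hi - lo).
    apply/negP => /(@uniq_iota_sub _ _ (hi - k.+1) k.+1) H.
    have : distinct_upto hi k.+1 by apply: H; lia.
    by rewrite distinct_uptoS ?Xin //; lia.
  exists (hi - k.+1), j1, (X (hi - k.+1)), xj1.
  split=> //; first by lia.
  rewrite (negbTE nu) big_ltn //.
  by apply: (reach_trans run2 (@reach_refl _ _ _ _ 0)); lia.
have uk1 : distinct_upto hi k.+1 by rewrite distinct_uptoS ?Xnin //; lia.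
have [|i2 [j2 [xi2 [xj2 [? ? ? ? run3]]]]] :=
  IH k.+1 j1 _ xj1 j1V XiV xj1V _ lohi uk1; first by lia.
exists i2, j2, xi2, xj2; split=> //.
by rewrite big_ltn //; apply: (reach_trans run2 run3); lia.
Qed.

Lemma reach_search m s lo hi i j xi xj md o :
    m <= V -> s <= V -> hi <= V -> md <= V ->
    i <= V -> j <= V -> xi <= V -> xj <= V -> lo <= hi ->
  exists i' j' xi' xj', [/\ i' <= V, j' <= V, xi' <= V, xj' <= V &
    reach (st 7 m s lo hi i j xi xj md o)
      (st (if distinct_upto hi (hi - lo) then 31 else 21)
         m s lo hi i' j' xi' xj' md o)
      (3 + 12 * search_cost hi (hi - lo))].
Proof.
move=> mV sV hiV mdV iV jV xiV xjV lohi.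
have [//|i' [j' [xi' [xj' [? ? ? ? run]]]]] :=
  @reach_scan m s lo hi md o (hi - lo) 0 j xi xj mV sV hiV mdV jV xiV xjV
    erefl lohi.
exists i', j', xi', xj'; split=> //.
apply: (@reach_trans _ _ _ _ 1 _ _ _ _ _ run); last by rewrite addnA.
by machine_step; rewrite addn0 subn0; exact: reach_refl.
Qed.

(** Worst-case bound, for the exhaustive phase, where nothing is averaged. *)
Lemma search_cost_le hi k : search_cost hi k <= k * k.
Proof.
rewrite /search_cost -[X in _ <= X * _]subn0 -sum_nat_const_nat.
rewrite big_nat [X in _ <= X]big_nat; apply: leq_sum => l /andP[_ lt].
by case: distinct_upto; rewrite ?muln1 ?muln0.
Qed.

Definition window_distinct (s : nat) : nat := uniq (map X (iota s n)).

Lemma reach_window m s lo hi i j xi xj o :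
    m <= V -> s + n <= V -> lo <= V -> hi <= V -> i <= V -> j <= V ->
    xi <= V -> xj <= V ->
  exists i' j' xi' xj', [/\ i' <= V, j' <= V, xi' <= V, xj' <= V &
    reach (st 33 m s lo hi i j xi xj 2 o)
      (st 39 m s s (s + n) i' j' xi' xj' 2 (rcons o (window_distinct s)))
      (12 * (n * n) + 10)].
Proof.
move=> mV snV loV hiV iV jV xiV xjV.
have [||||||||//|i' [j' [xi' [xj' [i'V j'V xi'V xj'V run1]]]]] :=
  @reach_search m s s (s + n) i j xi xj 2 o; try by lia.
move: run1; rewrite addKn => run1.
exists i', j', xi', xj'; split=> //.
apply: (@reach_trans _ _ _ _ 3 (12 * (n * n) + 7)); last by lia.
  by machine_step; rewrite addn0; machine_step; machine_step; exact: reach_refl.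
apply: (reach_trans run1 (T2 := 4)); last first.
  by have := search_cost_le (s + n) n; lia.
rewrite /window_distinct /distinct_upto addnK; case: uniq => /=.
  by machine_step; machine_step; exact: reach_refl.
by machine_step; machine_step; machine_step; machine_step; exact: reach_refl.
Qed.

Lemma reach_brute m s lo hi i j xi xj o d :
    m <= V -> n + n <= V -> s + d.+1 = n ->
    lo <= V -> hi <= V -> i <= V -> j <= V -> xi <= V -> xj <= V ->
  exists M,
    reach (st 33 m s lo hi i j xi xj 2 o)
      (Config 41 M (o ++ map window_distinct (iota s d.+1)))
      (d.+1 * (12 * (n * n) + 12)) /\ mem_bounded V (Config 41 M [::]).
Proof.
move=> mV nnV.
elim: d s lo hi i j xi xj o
  => [|d IH] s lo hi i j xi xj o sd loV hiV iV jV xiV xjV;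
have [|||||||//|i' [j' [xi' [xj' [i'V j'V xi'V xj'V run1]]]]] :=
  @reach_window m s lo hi i j xi xj o; try by lia.
  exists [:: n; 1; m; s.+1; s; s + n; i'; j'; xi'; xj'; 2; 0].
  split; last by rewrite /mem_bounded /=; lia.
  apply: (reach_trans run1 (T2 := 2)); last by lia.
  machine_step; machine_step; have -> : (s + 1 < n) = false by lia.
  by rewrite addn1 cats1; exact: reach_refl.
have [||||||//|M [run2 bM]] :=
  IH s.+1 s (s + n) i' j' xi' xj' (rcons o (window_distinct s)); try by lia.
exists M; split=> //.
rewrite [iota s _]/= map_cons -cat_rcons.
apply: (reach_trans run1 (T2 := 2 + d.+1 * (12 * (n * n) + 12))); last by lia.
apply: (@reach_trans _ _ _ _ 2 _ _ _ _ _ run2); last by [].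
machine_step; machine_step; have -> : (s + 1 < n) = true by lia.
by rewrite addn1; exact: reach_refl.
Qed.

Lemma reach_zeros m s lo hi i j xi xj o d :
    m <= V -> s + d.+1 = n -> lo <= V -> hi <= V -> i <= V -> j <= V ->
    xi <= V -> xj <= V ->
  exists M,
    reach (st 23 m s lo hi i j xi xj 1 o)
      (Config 41 M (o ++ nseq d.+1 0)) (3 * d.+1 + 1) /\
    mem_bounded V (Config 41 M [::]).
Proof.
move=> mV sd loV hiV iV jV xiV xjV.
elim: d s o sd => [|d IH] s o sd.
  exists [:: n; 1; m; s.+1; lo; hi; i; j; xi; xj; 1; 0].
  split; last by rewrite /mem_bounded /=; lia.
  machine_step; machine_step; machine_step.
  have -> : (s + 1 < n) = false by lia.
  by machine_step; rewrite addn1 cats1; exact: reach_refl.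
have [|M [run1 bM]] := IH s.+1 (rcons o 0); first by lia.
exists M; split=> //.
rewrite [nseq _.+2 _]/= -cat_rcons.
apply: (@reach_trans _ _ _ _ 3 _ _ _ _ _ run1); last by lia.
machine_step; machine_step; machine_step.
have -> : (s + 1 < n) = true by lia.
by rewrite addn1; exact: reach_refl.
Qed.

(** The machine cannot divide: it increments m until 2m >= n, in linear time. *)
Lemma reach_half m j d :
    n + 2 <= V -> j <= V -> 0 < n -> m + d.+1 = uphalf n ->
  exists j', reach (st 2 m 0 0 0 0 j 0 0 0 [::])
    (st 5 (uphalf n) 0 0 0 0 j' 0 0 0 [::]) (3 * d.+1) /\ j' <= V.
Proof.
move=> nV2 jV n0.
elim: d m j jV => [|d IH] m j jV md.
  exists (m + 1 + (m + 1)); split; last by lia.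
  machine_step; machine_step; machine_step.
  have -> : (m + 1 + (m + 1) < n) = false by lia.
  by rewrite -md; exact: reach_refl.
have [||j' [run1 j'V]] := IH (m + 1) (m + 1 + (m + 1)); try by lia.
exists j'; split=> //.
apply: (@reach_trans _ _ _ _ 3 _ _ _ _ _ run1); last by lia.
machine_step; machine_step; machine_step.
have -> : (m + 1 + (m + 1) < n) = true by lia.
exact: reach_refl.
Qed.

(** The cubic term is charged only if one of the two blocks has no repetition; 100 generously
    absorbs all instruction counts. *)
Definition run_cost : nat :=
  100 * (n + search_cost n (n - uphalf n) +
         search_cost (n + uphalf n) (uphalf n) +
         (distinct_upto n (n - uphalf n) ||
          distinct_upto (n + uphalf n) (uphalf n)) * (n * (n * n))).

Lemma window_distinct_eq0 s hi k :
    s <= hi - k -> hi - k + k <= s + n -> ~~ distinct_upto hi k ->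
  window_distinct s = 0.
Proof.
move=> le1 le2 nu; rewrite /window_distinct; case u: uniq => //.
by move: nu; rewrite /distinct_upto (uniq_iota_sub le1 le2 u).
Qed.

Lemma reach_output : 0 < n -> n + n + 2 <= V ->
  exists M, reach (Config 0 [:: n] [::])
      (Config 41 M (map window_distinct (iota 0 n))) run_cost /\
    mem_bounded V (Config 41 M [::]).
Proof.
move=> n0 nnV; set m := uphalf n; rewrite /run_cost -/m.
have nS : 0 + n.-1.+1 = n by lia.
have [||||j1 [run1 j1V]] := @reach_half 0 0 m.-1; try by rewrite ?/m; lia.
have {run1} run1 : reach (Config 0 [:: n] [::])
    (st 7 m 0 m n 0 j1 0 0 0 [::]) (4 + 3 * m).
  apply: (@reach_trans _ _ _ (st 2 0 0 0 0 0 0 0 0 0 [::]) 2 (2 + 3 * m)).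
  - by machine_step; machine_step; exact: reach_refl.
  - apply: (reach_trans run1 (T2 := 2)); last by rewrite /m; lia.
    machine_step; rewrite addn0; machine_step; rewrite addn0; exact: reach_refl.
  - by lia.
have [|||||||||i2 [j2 [xi2 [xj2 [i2V j2V xi2V xj2V run2]]]]] :=
  @reach_search m 0 m n 0 j1 0 0 0 [::]; try by rewrite ?/m; lia.
(* Shared by the failures of the left and the right search, hence any phase [md <= 1]. *)
have brute lo hi i j xi xj md T : lo <= V -> hi <= V -> i <= V -> j <= V ->
    xi <= V -> xj <= V -> md <= 1 ->
    reach (Config 0 [:: n] [::]) (st 31 m 0 lo hi i j xi xj md [::]) T ->
  exists M, reach (Config 0 [:: n] [::])
      (Config 41 M (map window_distinct (iota 0 n)))
      (T + (2 + n * (12 * (n * n) + 12))) /\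
    mem_bounded V (Config 41 M [::]).
  move=> loV hiV iV jV xiV xjV md1 run.
  have [||||||||//|M [runb bM]] := @reach_brute m 0 lo hi i j xi xj [::] n.-1;
    try by rewrite ?/m; lia.
  exists M; split=> //.
  move: runb; rewrite cat0s [n.-1.+1]nS => runb.
  apply: (reach_trans run _ (leqnn _)).
  apply: (@reach_trans _ _ _ _ 2 _ _ _ _ _ runb (leqnn _)).
  machine_step; have -> : (1 < md) = false by lia.
  by machine_step; exact: reach_refl.
have {run1 run2} run := reach_trans run1 run2 (leqnn _).
have cube : n <= n * (n * n) by nia.
have [u1|nu1] := boolP (distinct_upto n (n - m)).
  rewrite u1 in run.
  have [|||||||M [runb bM]] := brute _ _ _ _ _ _ _ _ _ _ _ _ _ _ _ run;
    try by rewrite ?/m; lia.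
  exists M; split=> //; apply: (reach_trans runb (@reach_refl _ _ _ _ 0)).
  by rewrite /= mul1n /m; nia.
rewrite (negbTE nu1) in run.
have [|||||||||i3 [j3 [xi3 [xj3 [i3V j3V xi3V xj3V run3]]]]] :=
  @reach_search m 0 n (n + m) i2 j2 xi2 xj2 1 [::]; try by rewrite ?/m; lia.
rewrite addKn in run3.
have {run run3} run : reach (Config 0 [:: n] [::])
    (st (if distinct_upto (n + m) m then 31 else 21) m 0 n (n + m)
       i3 j3 xi3 xj3 1 [::])
    (4 + 3 * m + (3 + 12 * search_cost n (n - m)) +
     (5 + (3 + 12 * search_cost (n + m) m))).
  apply: (reach_trans run _ (leqnn _)).
  apply: (@reach_trans _ _ _ _ 5 _ _ _ _ _ run3 (leqnn _)).
  machine_step; machine_step; machine_step; rewrite addn0.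
  by machine_step; machine_step; exact: reach_refl.
have [u2|nu2] := boolP (distinct_upto (n + m) m).
  rewrite u2 in run.
  have [|||||||M [runb bM]] := brute _ _ _ _ _ _ _ _ _ _ _ _ _ _ _ run;
    try by rewrite ?/m; lia.
  exists M; split=> //; apply: (reach_trans runb (@reach_refl _ _ _ _ 0)).
  by rewrite orbT /= mul1n /m; nia.
rewrite (negbTE nu2) in run.
have [||||||||M [runz bM]] := @reach_zeros m 0 n (n + m) i3 j3 xi3 xj3 [::] n.-1;
  try by rewrite ?/m; lia.
exists M; split=> //.
have -> : map window_distinct (iota 0 n) = nseq n 0.
  suff /all_pred1P : all (pred1 0) (map window_distinct (iota 0 n)).
    by rewrite size_map size_iota.
  apply/allP => _ /mapP[s sn ->] /=; apply/eqP.
  move: sn; rewrite mem_iota /= => sn.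
  have [le|ge] := leqP s m.
    by apply: window_distinct_eq0 nu1; rewrite /m; lia.
  by apply: window_distinct_eq0 nu2; rewrite /m; lia.
move: runz; rewrite [n.-1.+1]nS cat0s => runz.
apply: (reach_trans run (T2 := 2 + (3 * n + 1))).
  apply: (@reach_trans _ _ _ _ 2 _ _ _ _ _ runz (leqnn _)).
  by machine_step; machine_step; exact: reach_refl.
by rewrite /m; lia.
Qed.
End Program.

(** * Average running time *)

Lemma sum_distinct_upto n N hi k : k <= hi <= N ->
  \sum_(x : N.-tuple 'I_n) (distinct_upto (map val x) hi k : nat) =
    n ^_ k * n ^ (N - k).
Proof.
move=> /andP[khi hiN].
have /sum_uniq_segment - /(_ 'I_n) : hi - k + k <= N by lia.
rewrite card_ord => <-; apply: eq_bigr => x _; congr nat_of_bool.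
rewrite /distinct_upto map_nth_iota; last by rewrite size_map size_tuple; lia.
by rewrite -map_drop -map_take (map_inj_uniq val_inj).
Qed.

(** This is the hypothesis [qS] for the actual counts, with [q 0] equal to [n ^ N]. *)
Lemma distinct_countS n N k : k < N ->
  n * (n ^_ k.+1 * n ^ (N - k.+1)) = (n - k) * (n ^_ k * n ^ (N - k)).
Proof.
move=> kN; rewrite ffactnSr -[N - k]prednK ?subn_gt0 // -subnS expnS.
by rewrite mulnCA -mulnA [RHS]mulnCA.
Qed.

Lemma sum_search_cost n N hi K : 0 < n <= N -> K <= n -> K <= hi <= N ->
  \sum_(x : N.-tuple 'I_n) search_cost (map val x) hi K <= 3 * (n * n ^ N).
Proof.
move=> /andP[n0 nN] Kn /andP[Khi hiN].
have qS k : k < n -> _ := fun kn => @distinct_countS n N k (leq_trans kn nN).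
have := sum_weightsS qS n0 Kn; rewrite ffactn0 mul1n subn0.
apply: leq_trans; rewrite /search_cost exchange_big /= big_nat [X in _ <= X]big_nat.
apply: leq_sum => k /andP[_ kK].
by rewrite -big_distrr /= sum_distinct_upto //; lia.
Qed.

Lemma sum_run_cost : exists C, forall n, 1 < n ->
  \sum_(x : (2 * n - 1).-tuple 'I_n) run_cost n (map val x) <=
    C * (n * n ^ (2 * n - 1)).
Proof.
(* 7 = 1 + 3 + 3 pays for the linear term and the two searches; each possible failure adds 81 *
   61. *)
exists (100 * (7 + 2 * (81 * 61))) => n n1; set N := 2 * n - 1; set m := uphalf n.
have nN : n <= N by rewrite /N; lia.
have n0 : 0 < n by lia.
have qS k : k < n -> _ := fun kn => @distinct_countS n N k (leq_trans kn nN).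
have fail hi K : n <= 3 * K -> K <= n -> K <= hi <= N ->
    n * (n * n) * \sum_(x : N.-tuple 'I_n) (distinct_upto (map val x) hi K : nat) <=
    81 * 61 * (n * n ^ N).
  move=> nK Kn Khi; have := fail_weight qS n1 nK Kn.
  by rewrite ffactn0 mul1n subn0 sum_distinct_upto.
have c1 : \sum_(x : N.-tuple 'I_n) search_cost (map val x) n (n - m) <=
    3 * (n * n ^ N).
  by apply: sum_search_cost; lia.
have c2 : \sum_(x : N.-tuple 'I_n) search_cost (map val x) (n + m) m <=
    3 * (n * n ^ N).
  by apply: sum_search_cost; rewrite /m /N; lia.
have f1 : n * (n * n) * \sum_(x : N.-tuple 'I_n)
    (distinct_upto (map val x) n (n - m) : nat) <= 81 * 61 * (n * n ^ N).
  by apply: fail; rewrite /m /N; lia.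
have f2 : n * (n * n) * \sum_(x : N.-tuple 'I_n)
    (distinct_upto (map val x) (n + m) m : nat) <= 81 * 61 * (n * n ^ N).
  by apply: fail; rewrite /m /N; lia.
rewrite /run_cost -/m -big_distrr -mulnA leq_mul2l /=.
move: (81 * 61) f1 f2 => c f1 f2.
(* Union bound over the failures of the two searches. *)
apply: (@leq_trans (\sum_(x : N.-tuple 'I_n)
  (n + search_cost (map val x) n (n - m) + search_cost (map val x) (n + m) m +
   (n * (n * n) * distinct_upto (map val x) n (n - m) +
    n * (n * n) * distinct_upto (map val x) (n + m) m)))).
  apply: leq_sum => x _; rewrite leq_add2l -mulnDr mulnC leq_mul2l.
  by apply/orP; right; case: distinct_upto; case: distinct_upto.
rewrite !big_split /= -!big_distrr /= sum_nat_const card_tuple card_ord.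
rewrite [n ^ N * n]mulnC; move: (n * n ^ N) c1 c2 f1 f2 => A c1 c2 f1 f2.
have -> : (7 + 2 * c) * A = A + 3 * A + 3 * A + (c * A + c * A) by ring.
by rewrite !leq_add.
Qed.

(** * Space bound and correctness of the output *)

Lemma bitlen_le v w : v <= w -> bitlen v <= bitlen w.
Proof. by move=> vw; rewrite /bitlen ltnS leq_trunc_log. Qed.

Lemma config_space_le V c : mem_bounded V c -> config_space c <= 12 * bitlen V.
Proof.
case: c => p m o; rewrite /mem_bounded /config_space /= => /andP[szm mV].
apply: leq_trans (leq_mul szm (leqnn _)).
elim: m mV {szm} => [|v m IH] /=; first by rewrite big_nil.
by move=> /andP[vV /IH mV]; rewrite big_cons mulSn leq_add // bitlen_le.
Qed.

Lemma run_reach P n inp V p M out T :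
  reach P inp V (Config 0 [:: n] [::]) (Config p M out) T ->
  size P <= p -> mem_bounded V (Config p M [::]) ->
  exists t s, [/\ run P n inp out t s, t <= T & s <= 12 * bitlen V].
Proof.
move=> [t tT [et ht]] Pp bM.
exists t, (\max_(k < t.+1) config_space (config_at P n inp k)); split=> //.
  split=> //; rewrite /config_at ?et //.
  by move=> k /ht /andP[].
apply/bigmax_leqP => k _; apply: config_space_le.
have [kt|kt] := ltnP k t; first by have /andP[] := ht k kt.
have -> : k = t :> nat by have := ltn_ord k; lia.
by rewrite /config_at et.
Qed.

Lemma ED_window n (x : (2 * n - 1).-tuple 'I_n) (s : 'I_n) :
  ED (window x s) = window_distinct n (map val x) s.
Proof.
rewrite /ED /window_distinct; congr nat_of_bool.
rewrite -(map_inj_uniq val_inj) /= -[nat_of_ord s in RHS]addn0 iotaDl.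
rewrite -val_enum_ord -!map_comp.
congr uniq; apply: eq_map => j /=.
by rewrite (tnth_nth s) /= (nth_map s) // size_tuple window_bound.
Qed.

Lemma ED_boxplusE n (x : (2 * n - 1).-tuple 'I_n) :
  ED_boxplus x = map (window_distinct n (map val x)) (iota 0 n) :> seq nat.
Proof.
rewrite /= -val_enum_ord -map_comp.
by apply: eq_map => s; rewrite /= ED_window.
Qed.

Lemma ed_prog_run n (x : (2 * n - 1).-tuple 'I_n) : 0 < n ->
  exists t s, [/\ run ed_prog n (map val x) (ED_boxplus x) t s,
    t <= run_cost n (map val x) & s <= 12 * bitlen (n + n + 2)].
Proof.
move=> n0; rewrite ED_boxplusE.
have [||||| M [rM bM]] := @reach_output n (map val x) (n + n + 2);
  rewrite // ?leq_addl //; try lia.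
  by apply/allP => _ /mapP[i _ ->] /=; have := ltn_ord i; lia.
exact: (run_reach rM).
Qed.

(** For n > 1, 2n + 2 <= n^3 bounds the logarithm by 3 ln n / ln 2, and the extra bit costs at most
    one more ln n / ln 2; 48 = 12 * 4. *)
Lemma bitlen_le_ln (R : realType) n : 1 < n ->
  ((12 * bitlen (n + n + 2))%:R <= 48 / ln 2 * ln n%:R :> R)%R.
Proof.
move=> n1; set l := trunc_log 2 (n + n + 2).
have ln2 : (0 < ln 2 :> R)%R by rewrite ln_gt0 // (ltr_nat R 1 2).
have lnn : (ln 2 <= ln n%:R :> R)%R by rewrite ler_ln ?posrE ?ltr0n ?ler_nat //; lia.
have le2l : 2 ^ l <= n ^ 3.
  apply: leq_trans (trunc_logP _ _) _; rewrite ?addn2 //.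
  by rewrite !expnS expn0 muln1; nia.
have : (l%:R * ln 2 <= 3 * ln n%:R :> R)%R.
  rewrite !mulr_natl -!lnXn ?ltr0n //; last by lia.
  by rewrite -!natrX ler_ln ?posrE ?ltr0n ?expn_gt0 ?ler_nat //; lia.
rewrite /bitlen -/l mulrAC ler_pdivlMr // natrM => H.
rewrite -addn1 natrD; nra.
Qed.

(** * Asymptotics of the averages *)

Lemma average_le (R : realType) (I : finType) (f : I -> nat) (r : R) :
  ((\sum_(i : I) f i)%:R <= r * #|I|%:R)%R -> (0 <= r)%R -> (average R f <= r)%R.
Proof.
move=> H r0; rewrite /average; have [->|I0] := posnP #|I|.
  by rewrite invr0 mulr0.
by rewrite ler_pdivrMr // ltr0n.
Qed.

Lemma average_eqO (R : realType) (I : nat -> finType)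
    (f : forall n, I n -> nat) (g : nat -> R) (C : R) :
  (forall n, 1 < n -> (0 <= g n)%R) ->
  (forall n, 1 < n -> (average R (f n) <= C * g n)%R) ->
  (fun n => average R (f n)) =O_\oo g.
Proof.
move=> g0 le; apply/eqO_exP.
(* The constant of a big-O must be positive, which [C] need not be. *)
exists (Num.max C 1)%R; first by rewrite lt_max ltr01 orbT.
near=> n.
have n1 : 1 < n by near: n; exact: nbhs_infty_gt.
rewrite !ger0_norm ?g0 //; last by rewrite divr_ge0.
apply: le_trans (le n n1) _; apply: ler_wpM2r; first exact: g0.
by rewrite le_max lexx.
Unshelve. all: by end_near.
Qed.

Theorem theorem8 (R : realType) :
  exists (P : program)
    (time space : forall n : nat, (2 * n - 1).-tuple 'I_n -> nat),
    [/\ forall (n : nat) (x : (2 * n - 1).-tuple 'I_n), 0 < n ->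
          run P n (map val x) (ED_boxplus x) (time n x) (space n x),
        (fun n : nat => average R (time n)) =O_\oo
          (fun n : nat => n%:R%R : R)
      & (fun n : nat => average R (space n)) =O_\oo
          (fun n : nat => ln (n%:R%R : R))].
Proof.
(* Guarding the property by [0 < n] makes a pair exist for every input, so that choice yields total
   functions. *)
have runs n (x : (2 * n - 1).-tuple 'I_n) : exists ts : nat * nat, 0 < n ->
    [/\ run ed_prog n (map val x) (ED_boxplus x) ts.1 ts.2,
      ts.1 <= run_cost n (map val x) & ts.2 <= 12 * bitlen (n + n + 2)].
  case: n x => [|n] x; first by exists (0, 0).
  by have [t [s H]] := ed_prog_run x (ltn0Sn n); exists (t, s).
have runP n x := projT2 (cid (runs n x)).
exists ed_prog, (fun n x => (projT1 (cid (runs n x))).1),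
  (fun n x => (projT1 (cid (runs n x))).2); split.
- by move=> n x n0; have [] := runP n x n0.
- have [C costC] := sum_run_cost.
  apply: (@average_eqO _ _ _ _ C%:R) => n n1 //.
  apply: average_le; last by rewrite mulr_ge0.
  rewrite card_tuple card_ord -!natrM ler_nat -mulnA.
  apply: leq_trans (costC n n1); apply: leq_sum => x _.
  by have [] := runP n x (ltnW n1).
- apply: (@average_eqO _ _ _ _ (48 / ln 2)%R) => n n1.
    by rewrite ln_ge0 // ler1n ltnW.
  apply: le_trans (bitlen_le_ln R n1).
  apply: average_le => //; rewrite -natrM ler_nat [leqRHS]mulnC -sum_nat_const.
  apply: leq_sum => x _.
  by have [] := runP n x (ltnW n1).
Qed.
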